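(* Let $n\ge1$. The map $\phi:\rho\mapsto\pi_\rho$ defines an isomorphism of partially ordered sets $B_B(J_n,1)\to B_n$, where $B_n$ is ordered by the weak left Bruhat order.
   Context: **Type B orders for $k=1$.** Let $J_n=\{-n,\dots,-1,1,\dots,n\}$. Let $C_B(J_n,2)$ be the set consisting of: the classes $[a,b]$ of two-element subsets $\{a,b\}\subset J_n$ with $|a|\ne|b|$, modulo $\{a,b\}\sim\{-a,-b\}$ (these form $C_B^1(J_n,2)$); and the formal symbols $[k,\star]$ for $1\le k\le n$ (these form $C_B^2(J_n,2)$). To $K\in C_B(J_n,2)$ attach the packet $P_B(K)$, a partially ordered subset of $J_n$: for $K=[j,i]$, with representative chosen so that the element of greatest absolute value is negative ($j<0$, $|j|>|i|$), $P_B(K)=\{i,-i,j,-j\}$ with relations $j<i$ and $-i<-j$ only; for $K=[k,\star]$, $k>0$, $P_B(K)=\{k,-k\}$ with $-k<k$. $\mathrm{Rev}\,P_B(K)$ denotes the opposite order on the same set. A comparable component is a connected component of the Hasse diagram. A total order $\rho$ of $J_n$ is admissible if for every $K\in C_B(J_n,2)$ it extends $P_B(K)$ or $\mathrm{Rev}\,P_B(K)$. The set of admissible total orders is $A_B(J_n,1)=B_B(J_n,1)$ (no two distinct elements of $J_n$ commute, so the equivalence relation used for general $k$ is trivial). $\mathrm{Inv}(\rho)$ is the set of $K$ such that $\rho$ extends $\mathrm{Rev}\,P_B(K)$; $N(\rho)$ is the set of $K$ such that each comparable component of $P_B(K)$ is a set of consecutive elements in $\rho$. For $K\in N(\rho)$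 the packet flip $p_K(\rho)$ is obtained by reversing in place each comparable component of $P_B(K)$ in $\rho$. The partial order on $B_B(J_n,1)$: $\rho\le\rho'$ iff there are $\rho=\rho_0,\dots,\rho_m=\rho'$ ($m\ge 0$) and $K_1,\dots,K_m$ with $K_t\in N(\rho_{t-1})\setminus\mathrm{Inv}(\rho_{t-1})$ and $\rho_t=p_{K_t}(\rho_{t-1})$. **The map $\phi$.** For a total order $j_{-n}\prec j_{-n+1}\prec\cdots\prec j_{-1}\prec j_1\prec\cdots\prec j_n$ of $J_n$ (indices in $J_n$), called $\rho$, $\pi_\rho$ is the permutation of $J_n$ with $j_i\mapsto i$; $\phi(\rho)=\pi_\rho$. **The Weyl group.** $B_n$ is the group of permutations $\pi$ of $J_n$ with $\pi(-i)=-\pi(i)$ for all $i$, under composition. It acts on $\mathbb R^n$ by $e_i\mapsto \mathrm{sign}(\pi(i))\,e_{|\pi(i)|}$. Positive roots: $\Phi^+=\{e_i:1\le i\le n\}\cup\{e_i\pm e_j: i>j\}$, with simple roots $e_1$ and $e_i-e_{i-1}$ ($1<i\le n$); the simple reflections are the permutations $(-1,1)$ and $(-i,-i+1)(i,i-1)$ for $1<i\le n$. The length $l$ is the word length in these simple reflections. The weak left Bruhat order on $B_n$ is the partial order with covering relations $w<w'$ where $w'=sw$ for a simple reflection $s$ and $l(w')=l(w)+1$. *)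

(* Defs.v *)
From HB Require Import structures.
From mathcomp Require Import all_boot all_order all_algebra all_fingroup.
From mathcomp Require Import zify.

Set Implicit Arguments.
Unset Strict Implicit.
Unset Printing Implicit Defensive.

Import Order.TTheory GRing.Theory Num.Theory.
Local Open Scope ring_scope.

Record J (n : nat) : predArgType := JElt {
  jval :> int;
  _ : (jval != 0) && (`|jval| <= n)%N
}.

HB.instance Definition _ n := [isSub for @jval n].
HB.instance Definition _ n := [Choice of J n by <:].
HB.instance Definition _ n := [Countable of J n by <:].

Definition jints (n : nat) : seq int :=
  [seq - (i.+1%:Z) | i <- iota 0 n] ++ [seq i.+1%:Z | i <- iota 0 n].

Lemma mem_jints n (x : int) : (x \in jints n) = (x != 0) && (`|x| <= n)%N.
Proof.
rewrite mem_cat; apply/orP/andP => [[]/mapP[i]|[x0 xn]].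
- by rewrite mem_iota => ? ->; split; lia.
- by rewrite mem_iota => ? ->; split; lia.
- case: (ltP x 0) => hx; [left|right]; apply/mapP; exists (`|x|.-1)%N;
  rewrite ?mem_iota; lia.
Qed.

Lemma uniq_jints n : uniq (jints n).
Proof.
rewrite cat_uniq !map_inj_uniq ?iota_uniq /= ?andbT; last 2 first.
- by move=> i j; lia.
- by move=> i j; lia.
by apply/hasPn => x /mapP[i _ ->]; apply/mapP => -[j _]; lia.
Qed.

Definition jenum (n : nat) : seq (J n) := pmap insub (jints n).

Lemma jenum_axiom n : Finite.axiom (jenum n).
Proof.
apply: Finite.uniq_enumP; first by rewrite pmap_sub_uniq ?uniq_jints.
by case=> x hx; rewrite mem_pmap_sub mem_jints /= hx.
Qed.

HB.instance Definition _ n := isFinite.Build (J n) (@jenum_axiom n).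

Lemma card_J n : #|J n| = n.*2.
Proof.
rewrite cardT enumT unlock /= /jenum size_pmap_sub.
rewrite (eq_in_count (a2 := predT)) ?count_predT; last first.
  by move=> x; rewrite mem_jints.
by rewrite size_cat !size_map size_iota addnn.
Qed.

Lemma jopp_subproof n (x : J n) : (- jval x != 0) && (`|- jval x| <= n)%N.
Proof. by case: x => y /=; lia. Qed.

Definition jopp n (x : J n) : J n := JElt (jopp_subproof x).

Definition pair_class n (a b : J n) : {set {set J n}} :=
  [set [set a; b]; [set jopp a; jopp b]].

Definition pair_classes n : {set {set {set J n}}} :=
  [set c | [exists a : J n, [exists b : J n,
     (`|jval a| != `|jval b|)%N && (c == pair_class a b)]]].

(* [inl c] is a class [a, b]; [inr k] is the symbol [k, star]. *)
Definition CB (n : nat) : Type :=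
  ({c : {set {set J n}} | c \in pair_classes n} + {k : J n | 0 < jval k})%type.
HB.instance Definition _ n := Finite.on (CB n).

(* (j, i) is the representative whose entry of greatest absolute value,
   namely j, is negative. *)
Definition is_rep n (c : {set {set J n}}) (j i : J n) : bool :=
  [&& jval j < 0, (`|jval i| < `|jval j|)%N & c == pair_class j i].

Definition packet_set n (K : CB n) : {set J n} :=
  match K with
  | inl c => [set x | [exists j, [exists i,
      is_rep (val c) j i && (x \in [set i; jopp i; j; jopp j])]]]
  | inr k => [set val k; jopp (val k)]
  end.

(* Binary relations on J_n are sets of pairs; all orders are strict. *)
Definition packet_rel n (K : CB n) : {set J n * J n} :=
  match K with
  | inl c => [set p | [exists j, [exists i,
      is_rep (val c) j i && (p \in [set (j, i); (jopp i, jopp j)])]]]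
  | inr k => [set (jopp (val k), val k)]
  end.

Definition rev_rel n (R : {set J n * J n}) : {set J n * J n} :=
  [set p | (p.2, p.1) \in R].

Definition hasse n (K : CB n) : rel (J n) := fun x y =>
  ((x, y) \in packet_rel K) &&
  [forall z in packet_set K,
     ~~ (((x, z) \in packet_rel K) && ((z, y) \in packet_rel K))].

Definition same_component n (K : CB n) : rel (J n) := fun x y =>
  [&& x \in packet_set K, y \in packet_set K &
      connect (fun u v => hasse K u v || hasse K v u) x y].

Definition component n (K : CB n) (x : J n) : {set J n} :=
  [set y | same_component K x y].

Definition strict_total n (R : {set J n * J n}) : bool :=
  [&& [forall x, (x, x) \notin R],
      [forall x, forall y, forall z,
         ((x, y) \in R) && ((y, z) \in R) ==> ((x, z) \in R)] &
      [forall x, forall y, [|| x == y, (x, y) \in R | (y, x) \in R]]].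

Record torder (n : nat) : predArgType := TOrder {
  torel :> {set J n * J n};
  _ : strict_total torel
}.

HB.instance Definition _ n := [isSub for @torel n].
HB.instance Definition _ n := [Finite of torder n by <:].

Definition admissible n (rho : torder n) : bool :=
  [forall K : CB n, (packet_rel K \subset torel rho) ||
                    (rev_rel (packet_rel K) \subset torel rho)].

Definition BB (n : nat) : {set torder n} := [set rho | admissible rho].

Definition Inv n (rho : torder n) : {set CB n} :=
  [set K | rev_rel (packet_rel K) \subset torel rho].

Definition consecutive n (rho : torder n) (A : {set J n}) : bool :=
  [forall x in A, forall z in A, forall y,
     ((x, y) \in torel rho) && ((y, z) \in torel rho) ==> (y \in A)].

Definition Nbr n (rho : torder n) : {set CB n} :=
  [set K | [forall x in packet_set K, consecutive rho (component K x)]].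

(* When every component of the packet is an interval of rho, reversing each
   of them in place changes exactly the comparisons inside a component. *)
Definition packet_flip n (K : CB n) (rho : torder n) : {set J n * J n} :=
  [set p | if same_component K p.1 p.2 then (p.2, p.1) \in torel rho
           else p \in torel rho].

Definition flip_step n : rel (torder n) := fun rho rho' =>
  [exists K in Nbr rho :\: Inv rho, torel rho' == packet_flip K rho].

Definition leBB n : rel (torder n) := connect (@flip_step n).

Definition rank n (rho : torder n) (x : J n) : nat :=
  #|[set y | (y, x) \in torel rho]|.

(* The labels -n, ..., -1, 1, ..., n in increasing order skip 0, so the element
   with r predecessors is j_i for i = r - n if r < n and i = r - n + 1
   otherwise. *)
Definition label (n r : nat) : int :=
  if (r < n)%N then r%:Z - n%:Z else r%:Z - n%:Z + 1.

Lemma torder_irr n (rho : torder n) x : ((x, x) \in torel rho) = false.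
Proof. by case: rho => R /= /and3P[/forallP/(_ x)/negbTE]. Qed.

Lemma torder_trans n (rho : torder n) y x z :
  (x, y) \in torel rho -> (y, z) \in torel rho -> (x, z) \in torel rho.
Proof.
case: rho => R /= /and3P[_ h _] xy yz; move: h.
by move=> /forallP/(_ x)/forallP/(_ y)/forallP/(_ z)/implyP; apply; rewrite xy.
Qed.

Lemma torder_total n (rho : torder n) x y :
  [|| x == y, (x, y) \in torel rho | (y, x) \in torel rho].
Proof. by case: rho => R /= /and3P[_ _ /forallP/(_ x)/forallP/(_ y)]. Qed.

Lemma rank_lt n (rho : torder n) x : (rank rho x < n.*2)%N.
Proof.
rewrite -card_J -cardsT; apply: proper_card; apply/properP; split.
  exact: subsetT.
by exists x; rewrite ?inE // torder_irr.
Qed.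

Lemma rank_mono n (rho : torder n) x y :
  (x, y) \in torel rho -> (rank rho x < rank rho y)%N.
Proof.
move=> xy; apply: proper_card; apply/properP; split.
  by apply/subsetP => z; rewrite !inE => /torder_trans; apply.
by exists x; rewrite !inE ?torder_irr.
Qed.

Lemma rank_inj n (rho : torder n) : injective (rank rho).
Proof.
move=> x y exy; case/or3P: (torder_total rho x y) => [/eqP//|/rank_mono|/rank_mono];
by rewrite exy ltnn.
Qed.

Lemma label_subproof n (rho : torder n) x :
  (label n (rank rho x) != 0) && (`|label n (rank rho x)| <= n)%N.
Proof. by have := rank_lt rho x; rewrite /label; case: ifP; lia. Qed.

Definition pi_fun n (rho : torder n) (x : J n) : J n :=
  JElt (label_subproof rho x).

Lemma pi_fun_inj n (rho : torder n) : injective (pi_fun rho).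
Proof.
move=> x y /(congr1 (@jval n)); rewrite /= /label => h.
by apply: (@rank_inj _ rho); move: h; case: ifP; case: ifP; lia.
Qed.

Definition phi n (rho : torder n) : {perm J n} := perm (@pi_fun_inj n rho).

Definition WB (n : nat) : {set {perm J n}} :=
  [set w : {perm J n} | [forall x, w (jopp x) == jopp (w x)]].

Definition simple_refl (n : nat) : {set {perm J n}} :=
  [set s | [exists x : J n, (jval x == 1) && (s == tperm (jopp x) x)]] :|:
  [set s | [exists x : J n, [exists y : J n,
     [&& 0 < jval y, jval x == jval y + 1 &
         s == (tperm (jopp x) (jopp y) * tperm x y)%g]]]].

Lemma word_exists n (w : {perm J n}) :
  exists m, (w \in <<simple_refl n>>%g) ==> (w \in (simple_refl n ^+ m)%g).
Proof.
case: (boolP (w \in <<simple_refl n>>%g)) => [|_]; last by exists 0%N.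
case/gen_prodgP => m [c hc ->]; exists m => /=.
elim: m c hc => [|m IH] c hc; first by rewrite big_ord0 expg0 inE.
rewrite big_ord_recl expgS mem_mulg ?hc //.
by apply: (IH (fun i => c (lift ord0 i))) => i; apply: hc.
Qed.

(* The set power [simple_refl n ^+ m] is the set of products of m simple
   reflections, so this is the word length; it has the default value 0 outside
   the group generated by the simple reflections. *)
Definition length n (w : {perm J n}) : nat := ex_minn (word_exists w).

(* Products in {perm T} compose left to right, (w * s) x = s (w x), so w * s is
   the composite s o w: the left multiple of w by s under composition. *)
Definition weak_cover n : rel {perm J n} := fun w w' =>
  [exists s in simple_refl n,
     (w' == (w * s)%g) && (length w' == (length w).+1)].

Definition le_weak n : rel {perm J n} := connect (@weak_cover n).

(* Main.v *)
(** Positions turn an order rho into a permutation w = phi rho, and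
    (x, y) \in rho iff w x < w y; since a strictly monotone self-map of J_n is
    the identity, this is a bijection between total orders and permutations.
    Admissibility says that rho is reversed by negation, i.e. that w commutes
    with negation.

    A class K corresponds to a unique pair (j, i) with j < i <= -j, a positive
    root, and K is in Inv rho iff w j > w i. Multiplying w by a simple
    reflection s reverses the comparison of one such pair and no other, so
    the length of w is its number of inversions, and K can be flipped in rho
    exactly when w j and w i are adjacent positions; flipping K then amounts to
    replacing w by s o w. Hence flips of non-inverted packets are the covers of
    the weak order. *)
Require Import Defs.
From mathcomp Require Import all_boot all_order all_algebra all_fingroup.
From mathcomp Require Import zify.

Set Implicit Arguments.
Unset Strict Implicit.
Unset Printing Implicit Defensive.

Import Order.TTheory GRing.Theory Num.Theory.
Local Open Scope ring_scope.

(** * Monotone self-maps of [J n], and total orders as permutations *)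

Lemma J_eqE n (x y : J n) : (x == y) = (jval x == jval y).
Proof. by []. Qed.

Lemma jvalP n (x : J n) : (jval x != 0) && (`|jval x| <= n)%N.
Proof. by case: x. Qed.

Lemma joppK n : involutive (@jopp n).
Proof. by move=> x; apply: val_inj; rewrite /= opprK. Qed.

(** Induction on the distance from [-n]: if [f x < x], then [f (f x) < f x], against the induction
    hypothesis at [f x]. *)
Lemma J_monotone_ge n (f : J n -> J n) :
  (forall x y, jval x < jval y -> jval (f x) < jval (f y)) ->
  forall x, jval x <= jval (f x).
Proof.
move=> fm x; have [m] := ubnP (absz (jval x + n%:Z)); elim: m x => // m IH x hm.
case: leP => // hlt; have := fm _ _ hlt.
by have := IH (f x); have := jvalP x; have := jvalP (f x); lia.
Qed.

Lemma J_monotone_id n (f : J n -> J n) :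
  (forall x y, jval x < jval y -> jval (f x) < jval (f y)) -> f =1 id.
Proof.
move=> fm x; apply/val_inj/eqP; rewrite eq_le (J_monotone_ge fm) andbT /=.
(* The reverse inequality comes from the conjugate of [f] by negation, which is monotone too. *)
have /J_monotone_ge/(_ (jopp x)) : forall x y, jval x < jval y ->
    jval (jopp (f (jopp x))) < jval (jopp (f (jopp y))).
  by move=> y z yz; have := fm (jopp z) (jopp y); rewrite /=; lia.
by rewrite joppK /=; lia.
Qed.

Lemma torelE n (rho : torder n) x y :
  ((x, y) \in torel rho) = (jval (phi rho x) < jval (phi rho y)).
Proof.
have mono u v : (u, v) \in torel rho -> jval (phi rho u) < jval (phi rho v).
  by move=> /rank_mono; rewrite !permE /= /label; do 2!case: ifP; lia.
case: (boolP ((x, y) \in torel rho)) => [/mono->//|nxy].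
case/or3P: (torder_total rho x y) => [/eqP->|xy|/mono]; [by rewrite ltxx| |lia].
by rewrite xy in nxy.
Qed.

(** Both permutations represent the same order, so [phi rho] after the inverse of [w] is strictly
    monotone, hence the identity. *)
Lemma phi_unique n (rho : torder n) (w : {perm J n}) :
  (forall x y, ((x, y) \in torel rho) = (jval (w x) < jval (w y))) ->
  phi rho = w.
Proof.
move=> rw; apply/permP => x.
have /(@J_monotone_id n (fun u => phi rho (w^-1%g u)))/(_ (w x)) :
    forall u v, jval u < jval v ->
    jval (phi rho (w^-1%g u)) < jval (phi rho (w^-1%g v)).
  by move=> u v uv; rewrite -torelE rw !permKV.
by rewrite permK.
Qed.

Lemma phi_inj n : injective (@phi n).
Proof.
move=> rho rho' e; apply/val_inj/setP => -[x y] /=.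
by rewrite !torelE e.
Qed.

Lemma phi_surj n (w : {perm J n}) : exists rho : torder n, phi rho = w.
Proof.
pose R := [set p : J n * J n | jval (w p.1) < jval (w p.2)].
have Rt : strict_total R.
  apply/and3P; split; apply/forallP => x; first by rewrite inE ltxx.
    apply/forallP => y; apply/forallP => z; rewrite !inE /=.
    by apply/implyP => /andP[]; apply: lt_trans.
  by apply/forallP => y; rewrite !inE /= -(inj_eq (@perm_inj _ w)) J_eqE; lia.
by exists (TOrder Rt); apply: phi_unique => x y; rewrite inE.
Qed.

(** * Positive roots and the blocks of a packet *)

(* (j, j') with j' = -j stands for the short root e_|j|, that is, for the class
   [|j|, star]; the other pairs stand for the classes [j, i]. *)
Definition posroot n (p : J n * J n) : bool :=
  (jval p.1 < jval p.2) && (jval p.2 <= - jval p.1).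

(* [linked j i] is the relation "in the same comparable component" of the packet
   of (j, i); for i = -j its two blocks coincide. *)
Definition linked n (a b u v : J n) : bool :=
  (u \in [set a; b]) && (v \in [set a; b]) ||
  (u \in [set jopp a; jopp b]) && (v \in [set jopp a; jopp b]).

Lemma linkedE n (a b u v : J n) : linked a b u v =
  ((jval u == jval a) || (jval u == jval b)) &&
  ((jval v == jval a) || (jval v == jval b)) ||
  ((jval u == - jval a) || (jval u == - jval b)) &&
  ((jval v == - jval a) || (jval v == - jval b)).
Proof. by rewrite /linked !inE. Qed.

Lemma WBP n (w : {perm J n}) :
  reflect (forall x, jval (w (jopp x)) = - jval (w x)) (w \in WB n).
Proof.
rewrite inE; apply: (iffP forallP) => h x; first by rewrite (eqP (h x)).
by apply/eqP/val_inj/h.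
Qed.

Lemma perm_Jeq n (w : {perm J n}) x y : (jval (w x) == jval (w y)) = (jval x == jval y).
Proof. by rewrite -!J_eqE (inj_eq perm_inj). Qed.

Lemma linked_WB n (w : {perm J n}) a b u v : w \in WB n ->
  linked (w a) (w b) (w u) (w v) = linked a b u v.
Proof.
move/WBP => hw; rewrite !linkedE -!hw !perm_Jeq //=.
Qed.

(** Exchanging the two entries or negating both leaves [linked] unchanged, and these moves bring any
    pair of distinct labels into the form [j < i <= -j]. *)
Lemma linked_posroot n (x y : J n) : x != y ->
  exists2 q, posroot q & linked q.1 q.2 =2 linked x y.
Proof.
rewrite J_eqE => xy.
have [h|h] := leP (jval x + jval y) 0; have [h'|h'] := ltP (jval x) (jval y).
- by exists (x, y); rewrite // /posroot /=; lia.
- by exists (y, x); rewrite /posroot /=; [lia | move=> u v; rewrite !linkedE /=; lia].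
- exists (jopp y, jopp x); rewrite /posroot /=; first lia.
  by move=> u v; rewrite !linkedE /=; lia.
exists (jopp x, jopp y); rewrite /posroot /=; first lia.
by move=> u v; rewrite !linkedE /=; lia.
Qed.

(** Distinct roots never share a block. This is why a simple reflection changes the inversion status
    of a single root. *)
Lemma linked_posroots n (p q : J n * J n) : posroot p -> posroot q ->
  linked q.1 q.2 p.1 p.2 = (p == q).
Proof.
case: p q => [a b] [c d]; rewrite /posroot linkedE /= => pr qr.
by rewrite xpair_eqE !J_eqE; lia.
Qed.

(** * Adjacent labels and simple reflections *)

Definition adj n (a b : J n) : bool :=
  jval b == (if jval a == -1 then 1 else jval a + 1).

Lemma adjP n (a b : J n) :
  reflect (jval a < jval b /\ forall t : J n, ~~ (jval a < jval t < jval b))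
          (adj a b).
Proof.
apply: (iffP idP) => [|[ab h]]; rewrite /adj.
  by have ha := jvalP a => e; split=> [|t]; [|have := jvalP t];
    move: e; case: ifP; lia.
have [ha hb] := (jvalP a, jvalP b).
(* The successor of [a] lies in [J n] because [b] is above [a]; taking it for [t] forces [b] to be
   this successor. *)
have tP : ((if jval a == -1 then 1 else jval a + 1) != 0) &&
          (`|(if jval a == -1 then 1 else jval a + 1)%R| <= n)%N.
  by case: ifP; lia.
have := h (JElt tP); rewrite /=; case: ifP; lia.
Qed.

Lemma adj_posroot n (a b : J n) : adj a b ->
  exists2 q, posroot q & adj q.1 q.2 /\ linked q.1 q.2 =2 linked a b.
Proof.
move=> ab; have [ha hb] := (jvalP a, jvalP b).
have [h|h] := leP (jval a + jval b) 0.
  by exists (a, b) => //; move: ab; rewrite /adj /posroot /=; case: ifP; lia.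
exists (jopp b, jopp a); rewrite /= ?opprK.
  by move: ab; rewrite /adj /posroot /=; case: ifP; lia.
split; first by move: ab; rewrite /adj /=; do 2!case: ifP; lia.
by move=> u v; rewrite !linkedE /=; lia.
Qed.

(* For adjacent a and b this is a simple reflection: the case b = -a is the
   reflection (-1, 1). *)
Definition swap n (a b : J n) : {perm J n} :=
  if b == jopp a then tperm a b else (tperm a b * tperm (jopp a) (jopp b))%g.

Lemma swapE n (a b x : J n) : posroot (a, b) -> swap a b x =
  if x == a then b else if x == b then a else
  if x == jopp a then jopp b else if x == jopp b then jopp a else x.
Proof.
move=> rab; have [ha hb] := (jvalP a, jvalP b).
rewrite /swap; case: (eqVneq b (jopp a)) => [-> | nba].
  rewrite permE /= joppK.
  by case: eqP => // _; case: eqP => //.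
rewrite permM !permE /= (J_eqE b) /= in nba *.
case: (eqVneq x a) => [_|na]; last case: (eqVneq x b) => [_|nb] //.
  by rewrite !J_eqE /= !ifF //; move: rab nba; rewrite /posroot /=; lia.
by rewrite !J_eqE /= !ifF //; move: rab nba; rewrite /posroot /=; lia.
Qed.

Lemma adjE n (a b : J n) : adj a b =
  (jval b == jval a + 1) && (jval a != -1) || (jval a == -1) && (jval b == 1).
Proof. by rewrite /adj; case: ifP; lia. Qed.

(** Each block consists of neighbouring labels, so exchanging them cannot affect a comparison with a
    label outside the block. *)
Lemma swap_lt n (a b u v : J n) : posroot (a, b) -> adj a b ->
  (jval (swap a b u) < jval (swap a b v)) =
  if linked a b u v then jval v < jval u else jval u < jval v.
Proof.
move=> rab ab; rewrite !swapE // linkedE !J_eqE /=.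
move: ab rab (jvalP a) (jvalP u) (jvalP v); rewrite adjE /posroot /=.
move=> ab rab a0 u0 v0.
by repeat case: ifP => ?; rewrite /=; lia.
Qed.

Lemma swap_WB n (a b : J n) : posroot (a, b) -> swap a b \in WB n.
Proof.
move=> rab; apply/WBP => x; rewrite !swapE // !J_eqE /=.
move: rab (jvalP a) (jvalP b); rewrite /posroot /= => rab a0 b0.
by repeat case: ifP => ?; rewrite /=; lia.
Qed.

Lemma swapK n (a b : J n) : posroot (a, b) -> (swap a b * swap a b = 1)%g.
Proof.
move=> rab; apply/permP => x; apply/val_inj/eqP.
rewrite permM perm1; have := congr1 (@jval n) (swapE x rab).
move: (swap a b x) => y; rewrite swapE // !J_eqE /=.
move: rab (jvalP a) (jvalP b); rewrite /posroot /= => rab a0 b0.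
by repeat case: ifP => ?; rewrite /=; lia.
Qed.

(** An adjacent pair that is a root is [(-1, 1)] or [(-y-1, -y)] with [y > 0]; these give the two
    kinds of generators. *)
Lemma simple_reflP n (s : {perm J n}) :
  reflect (exists2 q, posroot q & adj q.1 q.2 /\ s = swap q.1 q.2)
          (s \in simple_refl n).
Proof.
rewrite !inE; apply: (iffP orP) => [[/existsP[x]|/existsP[x /existsP[y]]]|].
- case/andP=> /eqP x1 /eqP->; exists (jopp x, x); first by rewrite /posroot /=; lia.
  by rewrite /swap joppK eqxx adjE /=; split=> //; lia.
- case/and3P=> y0 /eqP xy /eqP->.
  exists (jopp x, jopp y); first by rewrite /posroot /=; lia.
  rewrite /swap /= !joppK adjE J_eqE /= ifF; last lia.
  by split=> //; lia.
case=> -[a b]; rewrite /posroot adjE /= => rab [ab ->].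
have [ha hb] := (jvalP a, jvalP b).
rewrite /swap; case: eqP => [e|/eqP].
  left; apply/existsP; exists b; rewrite e joppK eqxx andbT /=.
  by move/(congr1 (@jval n)): e => /=; lia.
rewrite J_eqE /= => nab; right; apply/existsP; exists (jopp a); apply/existsP.
by exists (jopp b); rewrite !joppK eqxx andbT /=; lia.
Qed.

Lemma WB1 n : 1%g \in WB n.
Proof. by apply/WBP => x; rewrite !perm1. Qed.

Lemma WBM n (w s : {perm J n}) : w \in WB n -> s \in WB n -> (w * s)%g \in WB n.
Proof.
move=> /WBP hw /WBP hs; apply/WBP => x; rewrite !permM -hs; congr (jval (s _)).
by apply: val_inj; rewrite /= hw.
Qed.

(** * Inversions and length *)

(** The second relation of the packet of [p]; it equals [p] exactly for the short roots. *)
Definition mirror n (p : J n * J n) : J n * J n := (jopp p.2, jopp p.1).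

Lemma linked_posroot_lt n (q : J n * J n) x y :
  posroot q -> jval x < jval y -> linked q.1 q.2 x y ->
  (x, y) \in [set q; mirror q].
Proof.
case: q => a b; rewrite /posroot linkedE !inE !xpair_eqE !J_eqE /=; lia.
Qed.

Lemma linked_lt n (w : {perm J n}) q x y : w \in WB n -> posroot q ->
  jval x < jval y -> linked q.1 q.2 x y ->
  (jval (w q.1) < jval (w q.2)) = (jval (w x) < jval (w y)).
Proof.
move/WBP=> hw rq xy lxy; have := linked_posroot_lt rq xy lxy.
by rewrite !inE => /orP[/eqP<-|/eqP[-> ->]]; rewrite ?hw //; lia.
Qed.

Definition invs n (w : {perm J n}) : {set J n * J n} :=
  [set p | posroot p && (jval (w p.2) < jval (w p.1))].

Lemma invs1 n : invs (1%g : {perm J n}) = set0.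
Proof. by apply/setP => -[x y]; rewrite !inE !perm1 /posroot /=; lia. Qed.

(** [swap a b] reverses the comparison of [w p.1] and [w p.2] only if [p] lies in a block of [q],
    and for a root [p] this means [p = q]. *)
Lemma invs_swap n (w : {perm J n}) a b q :
  posroot (a, b) -> adj a b -> posroot q ->
  (forall u v, linked q.1 q.2 u v = linked a b (w u) (w v)) ->
  invs (w * swap a b) = if q \in invs w then invs w :\ q else q |: invs w.
Proof.
move=> rab ab rq hq; apply/setP => p.
have [rp|nrp] := boolP (posroot p); last first.
  have npq : (p == q) = false by apply/eqP => pq; rewrite pq rq in nrp.
  by case: ifP; rewrite !inE (negbTE nrp) npq.
have -> : (p \in if q \in invs w then invs w :\ q else q |: invs w) =
          if p == q then q \notin invs w else p \in invs w.
  by case: ifP => qi; rewrite !inE; case: eqP => // ->; rewrite qi.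
rewrite !inE rp rq /= !permM swap_lt //.
have -> : linked a b (w p.2) (w p.1) = (p == q).
  rewrite -hq -(linked_posroots rp rq) !linkedE.
  by rewrite [X in X || _]andbC [X in _ || X]andbC.
have := perm_Jeq w p.1 p.2; move: rp; rewrite /posroot.
by have [<-|_] := eqVneq p q => /=; lia.
Qed.

Lemma swap_posroot n (w : {perm J n}) a b : w \in WB n -> posroot (a, b) ->
  exists2 q, posroot q & forall u v, linked q.1 q.2 u v = linked a b (w u) (w v).
Proof.
move=> hw rab.
have nab : (w^-1 a != w^-1 b)%g.
  by rewrite (inj_eq perm_inj) J_eqE; move: rab; rewrite /posroot /=; lia.
have [q rq hq] := linked_posroot nab; exists q => // u v.
by rewrite hq -(linked_WB _ _ _ _ hw) !permKV.
Qed.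

Lemma adj_monotone n (g : J n -> J n) :
  (forall a b, adj a b -> jval (g a) < jval (g b)) ->
  forall a b, jval a < jval b -> jval (g a) < jval (g b).
Proof.
move=> hg a b; have [m] := ubnP (absz (jval b - jval a)).
elim: m a b => // m IH a b hm ab.
case: (pickP (fun t : J n => jval a < jval t < jval b)) => [t|h].
  case/andP=> ha hb; apply: (@lt_trans _ _ (jval (g t))); apply: IH => //; lia.
by apply/hg/adjP; split=> // t; rewrite h.
Qed.

Lemma card_invs_swap_le n (w s : {perm J n}) : w \in WB n ->
  s \in simple_refl n -> (#|invs (w * s)| <= #|invs w|.+1)%N.
Proof.
move=> hw /simple_reflP[[a b] rab [ab ->]].
have [q rq hq] := swap_posroot hw rab.
rewrite (invs_swap rab ab rq hq) /=; case: ifP => qi.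
  by rewrite (leq_trans (subset_leq_card (subsetDl _ _))).
by rewrite cardsU1 qi.
Qed.

(** A monotone inverse would make [w] the identity, so the inverse of [w] reverses some adjacent
    pair of labels; swapping these labels removes one inversion. *)
Lemma invs_descent n (w : {perm J n}) : w \in WB n -> w != 1%g ->
  exists2 s, s \in simple_refl n & (#|invs (w * s)|.+1 = #|invs w|)%N.
Proof.
move=> hw w1.
have [a [b ab hab]] : exists a, exists2 b,
    adj a b & jval (w^-1%g b) < jval (w^-1%g a).
  case: (boolP [exists a, exists b,
      adj a b && (jval (w^-1%g b) < jval (w^-1%g a))]).
    by case/existsP=> a /existsP[b /andP[]]; exists a, b.
  move=> nex; have e : w^-1%g =1 id.
    apply: J_monotone_id; apply: adj_monotone => a b ab.
    have := existsPn nex a => /existsPn/(_ b); rewrite ab /=.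
    by have := perm_Jeq (w^-1)%g a b; have /adjP[] := ab; lia.
  by case/eqP: w1; apply/permP => x; rewrite perm1 -[RHS](permK w) e.
have [[c d] rcd [/= cd hcd]] := adj_posroot ab.
exists (swap c d); first by apply/simple_reflP; exists (c, d).
have [q rq hq] := swap_posroot hw rcd.
(* [(c, d)] may be the mirror of [(a, b)], so the inversion at [q] is read off from the preimages of
   [b] and [a] through [linked_lt]. *)
have qw : q \in invs w.
  have hba : linked q.1 q.2 (w^-1 b)%g (w^-1 a)%g.
    by rewrite hq !permKV hcd linkedE !eqxx /= orbT.
  have /adjP[lab _] := ab; have := linked_lt hw rq hab hba.
  have := perm_Jeq w q.1 q.2; rewrite !permKV inE rq /=.
  by move: rq; rewrite /posroot; lia.
by rewrite (invs_swap rcd cd rq hq) qw [RHS](cardsD1 q) qw.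
Qed.

(** Repeated descent writes [w] as a word with one letter per inversion; a letter adds at most one
    inversion, so no word is shorter. *)
Lemma card_invs_length n (w : {perm J n}) : w \in WB n -> length w = #|invs w|.
Proof.
have word m : forall v : {perm J n}, v \in WB n -> #|invs v| = m ->
    v \in (simple_refl n ^+ m)%g.
  elim: m => [|m IH] v hv hm; (have [v1|v1] := eqVneq v 1%g; last first).
  - by have [s _] := invs_descent hv v1; rewrite hm.
  - by rewrite v1 expg0 inE.
  - have [s hs] := invs_descent hv v1; rewrite hm => -[hvs].
    have /simple_reflP[q rq [_ es]] := hs.
    rewrite expgSr; apply/mulsgP; exists (v * s)%g s => //.
      by apply: IH => //; rewrite es WBM ?swap_WB // -surjective_pairing.
    by rewrite es -mulgA swapK -?surjective_pairing // mulg1.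
  - by move: hm; rewrite v1 invs1 cards0.
have bound m : forall v : {perm J n}, v \in (simple_refl n ^+ m)%g ->
    v \in WB n /\ (#|invs v| <= m)%N.
  elim: m => [|m IH] v.
    by rewrite expg0 inE => /eqP->; rewrite WB1 invs1 cards0.
  rewrite expgSr => /mulsgP[u s /IH[hu hm] hs ->]; split.
    have /simple_reflP[q rq [_ ->]] := hs.
    by rewrite WBM ?swap_WB // -surjective_pairing.
  by rewrite (leq_trans (card_invs_swap_le hu hs)).
move=> hw; have ww := word _ _ hw erefl.
(* Needed because [length] takes the default value 0 outside the generated subgroup. *)
have gw : w \in <<simple_refl n>>%g.
  apply: subsetP ww; elim: #|_| => [|m IH]; first by rewrite expg0 sub1G.
  by rewrite expgSr mul_subG ?subset_gen.
rewrite /length; case: ex_minnP => m; rewrite gw /= => /bound[_ lb] /(_ #|invs w|).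
by rewrite ww => /(_ isT) ub; apply/eqP; rewrite eqn_leq ub lb.
Qed.

(** * Classes as positive roots *)

(** Gives both kinds of classes one explicit form: for [[k, star]] the two relations coincide. *)
Definition encodes n (K : CB n) (q : J n * J n) : Prop :=
  [/\ posroot q, packet_rel K = [set q; mirror q] &
      packet_set K = [set q.2; jopp q.2; q.1; jopp q.1]].

Lemma encodes_inr n (k : {k : J n | 0 < jval k}) :
  encodes (inr k : CB n) (jopp (val k), val k).
Proof.
case: k => k k0; split=> /=; first by rewrite /posroot /=; lia.
  by rewrite /mirror /= joppK setUid.
by apply/setP => x; rewrite !inE !J_eqE /=; lia.
Qed.

Lemma encodes_inl n (c : {c | c \in pair_classes n}) j i :
  is_rep (val c) j i -> encodes (inl c : CB n) (j, i).
Proof.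
case/and3P=> j0 ij /eqP ec.
(* The pairs [{j, i}] and [{j', i'}] agree up to a common sign, and the sign is fixed because the
   entry of greatest absolute value is negative in both. *)
have uniq_rep j' i' : is_rep (val c) j' i' = (j' == j) && (i' == i).
  rewrite /is_rep ec; apply/and3P/andP => [[j0' ij' /eqP e]|[/eqP-> /eqP->]] //.
  have : [set j; i] \in pair_class j' i' by rewrite -e !inE eqxx.
  rewrite !inE => /orP[]/eqP/setP h.
    move: (h j) (h j') (h i); rewrite !inE !eqxx !orbT /= !J_eqE.
    by do 3![move/esym]; lia.
  move: (h j) (h (jopp j')) (h i); rewrite !inE !eqxx !orbT /= !J_eqE /=.
  by do 3![move/esym]; lia.
split; first by rewrite /posroot /=; lia.
- apply/setP => p; rewrite inE.
  apply/existsP/idP => [[j' /existsP[i']]|hp].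
    by rewrite uniq_rep => /andP[/andP[/eqP-> /eqP->]].
  by exists j; apply/existsP; exists i; rewrite uniq_rep !eqxx.
- apply/setP => p; rewrite inE.
  apply/existsP/idP => [[j' /existsP[i']]|hp].
    by rewrite uniq_rep => /andP[/andP[/eqP-> /eqP->]].
  by exists j; apply/existsP; exists i; rewrite uniq_rep !eqxx.
Qed.

Lemma pair_classC n (a b : J n) : pair_class a b = pair_class b a.
Proof.
by rewrite /pair_class ![[set b; a] in RHS]setUC (setUC [set jopp b]).
Qed.

Lemma pair_classN n (a b : J n) :
  pair_class (jopp a) (jopp b) = pair_class a b.
Proof. by rewrite /pair_class !joppK setUC. Qed.

Lemma encodes_root n (K : CB n) : exists q, encodes K q.
Proof.
case: K => [c|k]; last by exists (jopp (val k), val k); apply: encodes_inr.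
suff [j [i ji]] : exists j, exists i, is_rep (val c) j i.
  by exists (j, i); apply: encodes_inl.
have := valP c; rewrite inE => /existsP[a /existsP[b /andP[ab /eqP->]]].
wlog lab : a b ab / (`|jval a| < `|jval b|)%N.
  move=> hw; have [lt|le] := ltnP `|jval a|%N `|jval b|%N; first exact: hw.
  by rewrite pair_classC; apply: hw; lia.
have [b0|b0] := ltP (jval b) 0.
  by exists b, a; rewrite /is_rep pair_classC eqxx andbT; lia.
exists (jopp b), (jopp a); rewrite /is_rep pair_classN pair_classC eqxx /=.
by have := jvalP b; lia.
Qed.

Lemma posroot_encoded n (q : J n * J n) : posroot q -> exists K, encodes K q.
Proof.
case: q => j i; rewrite /posroot /= => rq; have := (jvalP j, jvalP i).
case=> hj hi; case: (eqVneq i (jopp j)) => [ei|]; last rewrite J_eqE /= => nij.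
  have k0 : 0 < jval i by move: rq; rewrite ei /=; lia.
  exists (inr (exist _ i k0)); have := encodes_inr (exist _ i k0).
  by rewrite /= (_ : jopp i = j) // ei joppK.
have hc : pair_class j i \in pair_classes n.
  by rewrite inE; apply/existsP; exists j; apply/existsP; exists i;
    rewrite eqxx andbT; lia.
exists (inl (exist (fun c => c \in pair_classes n) _ hc)); apply: encodes_inl.
by rewrite /is_rep eqxx /=; lia.
Qed.

Lemma same_componentE n (K : CB n) q : encodes K q ->
  same_component K =2 linked q.1 q.2.
Proof.
case: q => j i [rq rE sE] x y; have := (jvalP j, jvalP i) => -[hj hi].
(* Without chains of length two, the Hasse diagram is the packet relation itself. *)
have nchain u z v : (u, z) \in packet_rel K -> (z, v) \in packet_rel K -> False.
  by rewrite rE !inE !xpair_eqE !J_eqE /=; move: rq; rewrite /posroot /=; lia.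
have hE u v : hasse K u v = ((u, v) \in packet_rel K).
  apply/andP/idP => [[]//|huv]; split=> //; apply/forallP => z.
  by apply/implyP => _; apply/negP => /andP[]; apply: nchain.
apply/and3P/idP => [[xs ys xy]|].
  (* Each block is closed under Hasse edges, so connected elements share a block. *)
  have cl a b : (a, b) \in [set (j, i); (jopp j, jopp i)] ->
    (x \in [set a; b]) = (y \in [set a; b]).
    move=> hab; apply: closed_connect xy => u v; rewrite !hE rE.
    move: hab rq; rewrite /posroot /= !inE.
    move=> /orP[]/eqP[-> ->] rq /orP[]/orP[]/eqP[-> ->];
    by rewrite !J_eqE /=; lia.
  rewrite /linked /= -!cl ?inE ?eqxx ?orbT //.
  by move: xs; rewrite sE !inE !J_eqE /= !andbb; lia.
rewrite sE linkedE !inE !J_eqE /= => lxy; split; [lia|lia|].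
case: (eqVneq x y) => [->|]; first exact: connect0.
rewrite J_eqE => nxy; apply: connect1; rewrite /= !hE rE !inE !xpair_eqE !J_eqE /=.
by lia.
Qed.

(** * Admissible orders are the signed permutations *)

Lemma packet_sub n (rho : torder n) K q : phi rho \in WB n -> encodes K q ->
  (packet_rel K \subset torel rho) =
  (jval (phi rho q.1) < jval (phi rho q.2)).
Proof.
case: q => j i /WBP hw [_ -> _]; apply/subsetP/idP => [/(_ (j, i))|h [x y]].
  by rewrite torelE !inE eqxx => ->.
rewrite torelE !inE !xpair_eqE => /orP[]/andP[/eqP-> /eqP->] //=.
by rewrite !hw; move: h => /=; lia.
Qed.

Lemma rev_packet_sub n (rho : torder n) K q : phi rho \in WB n ->
  encodes K q ->
  (rev_rel (packet_rel K) \subset torel rho) =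
  (jval (phi rho q.2) < jval (phi rho q.1)).
Proof.
case: q => j i /WBP hw [_ rE _]; apply/subsetP/idP => [/(_ (i, j))|h [x y]].
  by rewrite torelE inE rE !inE eqxx => ->.
rewrite torelE inE /= rE !inE !xpair_eqE => /orP[]/andP[/eqP-> /eqP->] //=.
by rewrite !hw; move: h => /=; lia.
Qed.

Lemma mirrorK n : involutive (@mirror n).
Proof. by case=> x y; rewrite /mirror /= !joppK. Qed.

(** [(x, y)] and its mirror belong to the same packet, so [rho] keeps both or reverses both. *)
Lemma admissible_sym n (rho : torder n) x y : admissible rho ->
  jval x < jval y ->
  jval (phi rho (jopp x)) < jval (phi rho (jopp y)) /\
    jval (phi rho y) < jval (phi rho x) \/
  jval (phi rho (jopp y)) < jval (phi rho (jopp x)) /\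
    jval (phi rho x) < jval (phi rho y).
Proof.
move=> /forallP adm xy.
have nxy : x != y by rewrite J_eqE; lia.
have [q rq hq] := linked_posroot nxy; have [K [_ rE _]] := posroot_encoded rq.
have hxy : (x, y) \in packet_rel K.
  by rewrite rE; apply: linked_posroot_lt => //; rewrite hq linkedE !eqxx orbT.
have hyx : (jopp y, jopp x) \in packet_rel K.
  by move: hxy; rewrite rE !inE -(inj_eq (can_inj (@mirrorK n)) (x, y)) orbC
    -(inj_eq (can_inj (@mirrorK n)) (x, y)) mirrorK.
case/orP: (adm K) => /subsetP h; [right|left].
  by rewrite -!torelE !h.
by rewrite -!torelE !h // inE.
Qed.

Lemma BBE n (rho : torder n) : (rho \in BB n) = (phi rho \in WB n).
Proof.
rewrite inE; apply/idP/idP => [adm|hw]; last first.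
  apply/forallP => K; have [q eq] := encodes_root K.
  rewrite (packet_sub hw eq) (rev_packet_sub hw eq).
  by have := perm_Jeq (phi rho) q.1 q.2; case: eq; rewrite /posroot; lia.
have sym x y : jval (phi rho x) < jval (phi rho y) ->
    jval (phi rho (jopp y)) < jval (phi rho (jopp x)).
  have [xy|yx|/val_inj->] := ltgtP (jval x) (jval y); last by rewrite ltxx.
    by have := admissible_sym adm xy; lia.
  by have := admissible_sym adm yx; lia.
(* Since [rho] is reversed by negation, [f] is monotone, hence the identity; this says that
   [phi rho] commutes with negation. *)
pose f u := jopp (phi rho (jopp ((phi rho)^-1%g u))).
have /J_monotone_id fE u v : jval u < jval v -> jval (f u) < jval (f v).
  by rewrite -{1}[u](permKV (phi rho)) -{1}[v](permKV (phi rho)) => /sym /=; lia.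
apply/WBP => x; have := fE (phi rho x).
by rewrite /f permK => /(congr1 (@jval n)) /=; lia.
Qed.

(** * Packet flips are the covers of the weak order *)

Lemma flip_lt n (rho : torder n) K q a b : encodes K q ->
  posroot (a, b) -> adj a b ->
  (forall u v, linked q.1 q.2 u v = linked a b (phi rho u) (phi rho v)) ->
  forall x y, ((x, y) \in packet_flip K rho) =
    (jval ((phi rho * swap a b)%g x) < jval ((phi rho * swap a b)%g y)).
Proof.
move=> Kq rab ab hq x y; rewrite inE /= (same_componentE Kq) !torelE hq.
by rewrite !permM swap_lt.
Qed.

Lemma flip_phi n (rho rho' : torder n) K q a b : encodes K q ->
  posroot (a, b) -> adj a b ->
  (forall u v, linked q.1 q.2 u v = linked a b (phi rho u) (phi rho v)) ->
  (torel rho' == packet_flip K rho) = (phi rho' == (phi rho * swap a b)%g).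
Proof.
move=> Kq rab ab hq; have flip := flip_lt Kq rab ab hq.
apply/eqP/eqP => e; first by apply: phi_unique => x y; rewrite e flip.
by apply/setP => -[x y]; rewrite torelE e flip.
Qed.

(** The blocks [{a, b}] and [{-a, -b}] both consist of neighbouring labels, and they coincide if
    they meet. *)
Lemma linked_adj n (a b x u v y : J n) : adj a b ->
  linked a b x u -> linked a b x v -> ~~ (jval u < jval y < jval v).
Proof.
rewrite adjE !linkedE => ab; have := (jvalP a, jvalP b, jvalP y).
case=> -[a0 b0] y0 /orP[]/andP[xa ua] /orP[]/andP[xb vb];
by case/orP: xa => xa; case/orP: xb => xb; lia.
Qed.

Lemma Nbr_adj n (rho : torder n) K q : phi rho \in WB n -> encodes K q ->
  jval (phi rho q.1) < jval (phi rho q.2) ->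
  (K \in Nbr rho) = adj (phi rho q.1) (phi rho q.2).
Proof.
move=> hw Kq lq; rewrite inE; apply/forallP/idP => [con|ab x].
  apply/adjP; split=> // t; apply/negP => ht.
  have := con q.1; case: (Kq) => _ _ ->; rewrite !inE eqxx orbT /=.
  move/forallP/(_ q.1)/implyP; rewrite inE (same_componentE Kq) linkedE eqxx /=.
  move=> /(_ isT)/forallP/(_ q.2)/implyP.
  rewrite inE (same_componentE Kq) linkedE !eqxx orbT /= => /(_ isT).
  move=> /forallP/(_ ((phi rho)^-1%g t)); rewrite !torelE permKV ht /=.
  rewrite inE (same_componentE Kq) -(linked_WB _ _ _ _ hw) permKV linkedE.
  by move: ht lq; rewrite eqxx /=; lia.
apply/implyP => _; apply/forallP => u; apply/implyP => xu.
apply/forallP => v; apply/implyP => xv; apply/forallP => y; apply/implyP.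
move: xu xv; rewrite !inE !(same_componentE Kq) !torelE.
rewrite -(linked_WB _ _ x u hw) -(linked_WB _ _ x v hw) => xu xv uyv.
by rewrite (negbTE (linked_adj _ ab xu xv)) in uyv.
Qed.

Lemma flip_stepE n (rho rho' : torder n) : rho \in BB n ->
  flip_step rho rho' = weak_cover (phi rho) (phi rho').
Proof.
rewrite BBE => hw; apply/existsP/existsP => [[K /andP[/setDP[NK IK]]]|].
  have [q Kq] := encodes_root K; have [rq _ _] := Kq.
  have lq : jval (phi rho q.1) < jval (phi rho q.2).
    move: IK; rewrite inE (rev_packet_sub hw Kq).
    by have := perm_Jeq (phi rho) q.1 q.2; move: rq; rewrite /posroot; lia.
  rewrite (Nbr_adj hw Kq lq) in NK.
  (* The labels of [q] are adjacent but need not form a root; if not, the negated pair does, with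
     the same blocks. *)
  have [[a b] rab [ab hab]] := adj_posroot NK; rewrite /= in ab hab.
  have hq u v : linked q.1 q.2 u v = linked a b (phi rho u) (phi rho v).
    by rewrite hab linked_WB.
  rewrite (flip_phi rho' Kq rab ab hq) => /eqP e.
  exists (swap a b); apply/and3P; split; last 1 first.
  - rewrite e !card_invs_length ?WBM ?swap_WB // (invs_swap rab ab rq hq).
    rewrite inE rq /= ltNge ltW //= cardsU1 inE rq /= ltNge ltW //.
  - by apply/simple_reflP; exists (a, b).
  - by rewrite e.
case=> s /and3P[/simple_reflP[[a b] rab [ab ->]] /eqP e]; rewrite /= in ab.
have [q rq hq] := swap_posroot hw rab.
rewrite e !card_invs_length ?WBM ?swap_WB // (invs_swap rab ab rq hq).
(* If [q] were already inverted, the swap would remove an inversion and the length could not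
   grow. *)
case: ifP => [qi /eqP|nqi _].
  move=> h; have := subset_leq_card (subsetDl (invs (phi rho)) [set q]).
  by rewrite h ltnn.
have lq : jval (phi rho q.1) < jval (phi rho q.2).
  move: nqi; rewrite inE rq /=.
  by have := perm_Jeq (phi rho) q.1 q.2; move: rq; rewrite /posroot; lia.
have [K Kq] := posroot_encoded rq; exists K.
rewrite (flip_phi rho' Kq rab ab hq) e eqxx andbT; apply/setDP; split.
  rewrite (Nbr_adj hw Kq lq).
  (* The labels of [q] are [(a, b)] or its mirror, and both are adjacent pairs. *)
  have : (phi rho q.1, phi rho q.2) \in [set (a, b); mirror (a, b)].
    by apply: linked_posroot_lt => //; rewrite -hq linkedE !eqxx orbT.
  rewrite !inE !xpair_eqE => /orP[]/andP[/eqP-> /eqP->] //=.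
  by move: ab; rewrite !adjE /=; have := (jvalP a, jvalP b) => -[]; lia.
by rewrite inE (rev_packet_sub hw Kq) -leNgt ltW.
Qed.

(** Keeps chains of covers inside [WB n], so that [flip_stepE] applies at every step. *)
Lemma weak_cover_WB n (w w' : {perm J n}) :
  weak_cover w w' -> w \in WB n -> w' \in WB n.
Proof.
case/existsP=> s /and3P[/simple_reflP[[a b] rab [_ ->]] /eqP-> _] hw.
by rewrite WBM // swap_WB.
Qed.

Theorem theorem20 (n : nat) (hn : (1 <= n)%N) :
  [/\ [set phi rho | rho in BB n] = WB n,
      {in BB n &, injective (@phi n)} &
      {in BB n &, forall rho rho' : torder n,
         leBB rho rho' = le_weak (phi rho) (phi rho')}].
Proof.
split=> [|rho rho' _ _ /phi_inj //|rho rho' hr _].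
  apply/setP => w; apply/imsetP/idP => [[rho hr ->]|hw]; first by rewrite -BBE.
  by have [rho e] := phi_surj w; exists rho; rewrite // BBE e.
apply/connectP/connectP => -[p].
  elim: p rho hr => [|rho1 p IH] rho hr /=; first by move=> _ ->; exists [::].
  case/andP=> st pth lst; have := st; rewrite flip_stepE // => cov.
  have hr1 : rho1 \in BB n by rewrite BBE (weak_cover_WB cov) // -BBE.
  have [p' pth' lst'] := IH rho1 hr1 pth lst.
  by exists (phi rho1 :: p') => //=; rewrite cov.
elim: p rho hr => [|w p IH] rho hr /=.
  by move=> _ /phi_inj->; exists [::].
(* A chain of covers is lifted to orders one step at a time by surjectivity of [phi]. *)
case/andP=> cov pth lst; have [rho1 e1] := phi_surj w; rewrite -e1 in cov pth lst.
have hr1 : rho1 \in BB n by rewrite BBE (weak_cover_WB cov) // -BBE.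
have [p' pth' lst'] := IH rho1 hr1 pth lst.
by exists (rho1 :: p') => //=; rewrite flip_stepE // cov.
Qed.
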